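(* There exist unitaries $V_0, V_1, V_2, V_3, V_4$ acting on four qubits (three ancilla qubits, labelled $1,2,3$, and one target qubit), all independent of $U$, with the following property. For every $U \in SU(2)$ define $$C_{\mathrm{IV}}(U) = V_4\,(I_{123}\otimes U)\,V_3\,(I_{123}\otimes U)\,V_2\,(I_{123}\otimes U)\,V_1\,(I_{123}\otimes U)\,V_0,$$ where $I_{123}$ is the identity on the three ancilla qubits and $U$ acts on the target qubit; thus $U$ is used exactly 4 times. Then for every $U\in SU(2)$ there is a unit vector $|\chi_U\rangle$ on qubits $2,3$, independent of the input $|\psi\rangle$, such that for every single-qubit state $|\psi\rangle$ $$C_{\mathrm{IV}}(U)\,|0\rangle_1|0\rangle_2|0\rangle_3|\psi\rangle = |0\rangle_1\otimes|\chi_U\rangle_{23}\otimes U^{-1}|\psi\rangle .$$ Equivalently, after tracing out ancilla qubits $2$ and $3$, the output is $|0\rangle\langle 0|_1\otimes U^{-1}|\psi\rangle\langle\psi|U$. So $U^{-1}$ is implemented deterministically and exactly using 3 ancilla qubits and 4 queries of $U$.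
   Context: All systems are qubits ($\mathbb{C}^2$). $SU(2)$ denotes the $2\times 2$ unitary matrices with determinant $1$. For a general $U\in U(2)$, the same statement holds up to a global phase of the output state, that is, at the level of quantum channels. *)

(* Defs.v *)
From mathcomp Require Import all_boot all_order all_algebra.
Set Implicit Arguments. Unset Strict Implicit. Unset Printing Implicit Defensive.
Import Order.TTheory GRing.Theory Num.Theory.
Local Open Scope ring_scope.

Lemma kron_div_lt m p (i : 'I_(m * p)) : (i %/ p < m)%N.
Proof.
case: i => i /= Hi; case: p Hi => [|p] Hi; first by rewrite muln0 in Hi.
by rewrite ltn_divLR.
Qed.

Lemma kron_mod_lt m p (i : 'I_(m * p)) : (i %% p < p)%N.
Proof.
case: i => i /= Hi; case: p Hi => [|p] Hi; first by rewrite muln0 in Hi.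
by rewrite ltn_mod.
Qed.

Definition kdiv m p (i : 'I_(m * p)) : 'I_m := Ordinal (kron_div_lt i).
Definition kmod m p (i : 'I_(m * p)) : 'I_p := Ordinal (kron_mod_lt i).

(* Kronecker (tensor) product, big-endian: the left factor is the most
   significant index, i.e. (A (x) B)[(a,b),(c,d)] = A a c * B b d. *)
Definition kron (R : pzRingType) m n p q (A : 'M[R]_(m, n)) (B : 'M[R]_(p, q))
  : 'M[R]_(m * p, n * q) :=
  \matrix_(i, j) (A (kdiv i) (kdiv j) * B (kmod i) (kmod j)).

Definition mxadj (C : numClosedFieldType) m n (A : 'M[C]_(m, n)) : 'M[C]_(n, m) :=
  (map_mx Num.conj A)^T.

Definition unitary (C : numClosedFieldType) n (A : 'M[C]_n) : Prop :=
  A *m mxadj A = 1%:M.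

Definition SU2 (C : numClosedFieldType) (U : 'M[C]_2) : Prop :=
  unitary U /\ \det U = 1.

Definition unit_vec (C : numClosedFieldType) n (v : 'cV[C]_n) : Prop :=
  mxadj v *m v = 1%:M.

Definition ket0 (C : numClosedFieldType) : 'cV[C]_2 := delta_mx 0 0.

(* I_{123} (x) U : U acts on the target (4th, least significant) qubit. *)
Definition on_target (C : numClosedFieldType) (U : 'M[C]_2) : 'M[C]_16 :=
  kron (1%:M : 'M[C]_8) U.

Definition C_IV (C : numClosedFieldType) (V0 V1 V2 V3 V4 : 'M[C]_16)
  (U : 'M[C]_2) : 'M[C]_16 :=
  V4 *m on_target U *m V3 *m on_target U *m V2 *m on_target U *m V1
     *m on_target U *m V0.

Definition input_state (C : numClosedFieldType) (psi : 'cV[C]_2) : 'cV[C]_16 :=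
  kron (kron (kron (ket0 C) (ket0 C)) (ket0 C)) psi.

Definition output_state (C : numClosedFieldType) (chi : 'cV[C]_4)
  (phi : 'cV[C]_2) : 'cV[C]_16 :=
  kron (kron (ket0 C) chi) phi.

(* Main.v *)
(* Let q_0 = 1, q_1, q_2, q_3 be the quaternion units in SU(2), so that
   sum_p q_p M q_p^* = 2 tr M. Consider two kinds of states, |s,p> being ancilla
   basis vectors:
     C(c, e) = c |0,0> psi + e sum_(p <> 0) |1,p> U q_p U^-1 psi,
     I(a, b) = a |0,0> U^-1 psi + b sum_(p <> 0) |0,p> U^-1 q_p psi.
   Since U^-1 = adj U is an affine combination of the q_p^* U q_p, one query of
   U, preceded and followed by fixed unitaries, turns C(c, e) into
   I((c + 3e)/2, (c - e)/2). One further query cancels U^-1 in the branch p <> 0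
   and conjugates the q_p in the branch p = 0, turning I(a, b) into
   C(sqrt 3 b, a / sqrt 3). Starting from C(1, 0), which is the input, four
   queries give
     I(1/2, 1/2), C(sqrt 3 / 2, 1 / (2 sqrt 3)), I(sqrt 3 / 2, 1 / (2 sqrt 3)),
     C(1/2, 1/2),
   and the last state is 1/2 sum_p |p> U q_p U^-1 psi: it is the product
   of U^-1 psi with the normalised Choi vector of U, up to a fixed unitary. *)
Require Import Defs.
From mathcomp Require Import all_boot all_order all_algebra.
From mathcomp Require Import ring.
Set Implicit Arguments. Unset Strict Implicit. Unset Printing Implicit Defensive.
Import GRing.Theory Num.Theory.
Local Open Scope ring_scope.

(** * Adjoints, unitarity and reflections *)

Section Adjoint.
Variable C : numClosedFieldType.

Lemma mxadjM m n p (A : 'M[C]_(m, n)) (B : 'M[C]_(n, p)) :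
  mxadj (A *m B) = mxadj B *m mxadj A.
Proof. by rewrite /mxadj map_mxM trmx_mul. Qed.

Lemma mxadjB m n (A B : 'M[C]_(m, n)) : mxadj (A - B) = mxadj A - mxadj B.
Proof. by rewrite /mxadj map_mxB linearB. Qed.

Lemma mxadjN m n (A : 'M[C]_(m, n)) : mxadj (- A) = - mxadj A.
Proof. by rewrite /mxadj map_mxN linearN. Qed.

Lemma mxadjZ m n c (A : 'M[C]_(m, n)) : mxadj (c *: A) = c^* *: mxadj A.
Proof. by rewrite /mxadj map_mxZ linearZ. Qed.

Lemma mxadjK m n (A : 'M[C]_(m, n)) : mxadj (mxadj A) = A.
Proof. by apply/matrixP => i j; rewrite !mxE conjCK. Qed.

Lemma mxadj0 m n : mxadj (0 : 'M[C]_(m, n)) = 0.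
Proof. by rewrite /mxadj map_mx0 trmx0. Qed.

Lemma mxadj1 n : mxadj (1%:M : 'M[C]_n) = 1%:M.
Proof. by rewrite /mxadj map_mx1 trmx1. Qed.

Lemma unitaryM n (A B : 'M[C]_n) : unitary A -> unitary B -> unitary (A *m B).
Proof.
by move=> uA uB; rewrite /unitary mxadjM mulmxA -(mulmxA A) uB mulmx1.
Qed.

(** For [c] real with [c *: (mxadj D *m D) = 2%:M], this is 2P - 1, where P projects orthogonally
    onto the range of [D]; [c] absorbs the normalisation of [D]. *)
Definition reflection m n (c : C) (D : 'M[C]_(m, n)) : 'M[C]_m :=
  c *: (D *m mxadj D) - 1%:M.

Lemma unitary_reflection m n c (D : 'M[C]_(m, n)) :
  c^* = c -> c *: (mxadj D *m D) = 2%:M -> unitary (reflection c D).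
Proof.
move=> c_real normD; set P := c *: (D *m mxadj D).
have PE : mxadj P = P by rewrite mxadjZ c_real mxadjM mxadjK.
have P2 : P *m P = 2 *: P.
  rewrite {1}/P -scalemxAl {1}/P -scalemxAr mulmxA -(mulmxA D).
  rewrite scalemxAl (scalemxAr c D).
  by rewrite normD mul_mx_scalar -scalemxAl scalerA mulrC -scalerA.
rewrite /unitary /reflection -/P mxadjB PE mxadj1 mulmxBl mulmxBr mul1mx mulmx1 P2.
by rewrite scaler_nat mulr2n addrK opprB addrC subrK.
Qed.

End Adjoint.

(** * Four-qubit matrices as arrays of blocks on the target *)

Section Blocks.
Variable C : numClosedFieldType.

(* An index of 'I_16 is split as (s, p, t): [s] is the first ancilla qubit,
   [p] the two others, [t] the target. *)
Definition bcol n (F : 'I_2 -> 'I_4 -> 'M[C]_(2, n)) : 'M[C]_(16, n) :=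
  \matrix_(i, j) F (@kdiv 2 4 (@kdiv 8 2 i)) (@kmod 2 4 (@kdiv 8 2 i))
                   (@kmod 8 2 i) j.

Definition bmx (M : 'I_2 -> 'I_4 -> 'I_2 -> 'I_4 -> 'M[C]_2) : 'M[C]_16 :=
  \matrix_(i, j) M (@kdiv 2 4 (@kdiv 8 2 i)) (@kmod 2 4 (@kdiv 8 2 i))
                   (@kdiv 2 4 (@kdiv 8 2 j)) (@kmod 2 4 (@kdiv 8 2 j))
                   (@kmod 8 2 i) (@kmod 8 2 j).

Lemma kdiv_kmod_inj m p (i j : 'I_(m * p)) :
  kdiv i = kdiv j -> kmod i = kmod j -> i = j.
Proof.
move=> /(congr1 val) /= Ed /(congr1 val) /= Em; apply: val_inj => /=.
by rewrite (divn_eq i p) Ed Em -divn_eq.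
Qed.

Lemma kdiv_kmod_bij m p :
  bijective (fun i : 'I_(m * p) => (kdiv i, kmod i)).
Proof.
apply: inj_card_bij; last by rewrite card_prod !card_ord.
by move=> i j [Ed Em]; apply: kdiv_kmod_inj; apply: val_inj.
Qed.

Lemma sum_kdiv_kmod (V : nmodType) m p (f : 'I_m -> 'I_p -> V) :
  \sum_(i : 'I_(m * p)) f (kdiv i) (kmod i) = \sum_i \sum_j f i j.
Proof.
rewrite pair_big /= (reindex (fun i : 'I_(m * p) => (kdiv i, kmod i))) //=.
exact/onW_bij/kdiv_kmod_bij.
Qed.

Lemma sum_blocks (V : nmodType) (f : 'I_2 -> 'I_4 -> 'I_2 -> V) :
  \sum_(i < 16) f (@kdiv 2 4 (@kdiv 8 2 i)) (@kmod 2 4 (@kdiv 8 2 i))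
                  (@kmod 8 2 i)
  = \sum_s \sum_p \sum_t f s p t.
Proof.
rewrite -(@sum_kdiv_kmod V 2 4 (fun s p => \sum_t f s p t)).
exact: (@sum_kdiv_kmod V 8 2 (fun k t => f (@kdiv 2 4 k) (@kmod 2 4 k) t)).
Qed.

Lemma mul_bmx_bcol n M (F : 'I_2 -> 'I_4 -> 'M[C]_(2, n)) :
  bmx M *m bcol F
  = bcol (fun s p => \sum_s' \sum_p' M s p s' p' *m F s' p').
Proof.
apply/matrixP => i j; rewrite !mxE summxE.
under eq_bigr => k _ do rewrite !mxE.
rewrite (sum_blocks (fun s p t => M _ _ s p _ t * F s p t j)).
apply: eq_bigr => s _; rewrite summxE; apply: eq_bigr => p _.
by rewrite !mxE.
Qed.

Lemma mul_bmx M N :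
  bmx M *m bmx N
  = bmx (fun s p s' p' => \sum_a \sum_b M s p a b *m N a b s' p').
Proof.
apply/matrixP => i j; rewrite !mxE summxE.
under eq_bigr => k _ do rewrite !mxE.
rewrite (sum_blocks (fun s p t => M _ _ s p _ t * N s p _ _ t _)).
apply: eq_bigr => s _; rewrite summxE; apply: eq_bigr => p _.
by rewrite !mxE.
Qed.

Lemma mxadj_bcol_mul n k (F : 'I_2 -> 'I_4 -> 'M[C]_(2, n))
    (H : 'I_2 -> 'I_4 -> 'M[C]_(2, k)) :
  mxadj (bcol F) *m bcol H = \sum_s \sum_p mxadj (F s p) *m H s p.
Proof.
apply/matrixP => i j; rewrite !mxE summxE.
under eq_bigr => l _ do rewrite !mxE.
rewrite (sum_blocks (fun s p t => (F s p t i)^* * H s p t j)).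
apply: eq_bigr => s _; rewrite summxE; apply: eq_bigr => p _.
by rewrite !mxE; apply: eq_bigr => t _; rewrite !mxE.
Qed.

Lemma eq_bcol n (F H : 'I_2 -> 'I_4 -> 'M[C]_(2, n)) :
  (forall s p, F s p = H s p) -> bcol F = bcol H.
Proof. by move=> FH; apply/matrixP => i j; rewrite !mxE FH. Qed.

Lemma bcol_mul n k (F : 'I_2 -> 'I_4 -> 'M[C]_(2, n)) (A : 'M[C]_(n, k)) :
  bcol F *m A = bcol (fun s p => F s p *m A).
Proof.
by apply/matrixP => i j; rewrite !mxE; apply: eq_bigr => l _; rewrite !mxE.
Qed.

Lemma mxadj_bmx M :
  mxadj (bmx M) = bmx (fun s p s' p' => mxadj (M s' p' s p)).
Proof. by apply/matrixP => i j; rewrite !mxE. Qed.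

Lemma bmx1 M :
  (forall s p s' p', M s p s' p' = (((s == s') && (p == p'))%:R)%:M) ->
  bmx M = 1%:M.
Proof.
move=> ME; apply/matrixP => i j; rewrite !mxE ME !mxE -mulrnA mulnb.
congr (_ %:R); congr (nat_of_bool _).
apply/andP/eqP => [[/andP[/eqP Es /eqP Ep] /eqP Et]|->]; last by rewrite !eqxx.
apply: (@kdiv_kmod_inj 8 2) => //; exact: (@kdiv_kmod_inj 2 4).
Qed.

(** Evaluating a reflection on a column takes only the small product of [mxadj D] with [F]. *)
Lemma mul_reflection_bcol n k c (D : 'I_2 -> 'I_4 -> 'M[C]_(2, n))
    (F : 'I_2 -> 'I_4 -> 'M[C]_(2, k)) :
  reflection c (bcol D) *m bcol F
  = bcol (fun s p =>
      c *: (D s p *m \sum_s' \sum_p' mxadj (D s' p') *m F s' p') - F s p).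
Proof.
rewrite mulmxBl mul1mx -scalemxAl -mulmxA mxadj_bcol_mul bcol_mul.
by apply/matrixP => i j; rewrite !mxE.
Qed.

Lemma mul_on_target_bcol n (U : 'M[C]_2) (F : 'I_2 -> 'I_4 -> 'M[C]_(2, n)) :
  on_target U *m bcol F = bcol (fun s p => U *m F s p).
Proof.
have -> : on_target U
  = bmx (fun s p s' p' => ((s == s') && (p == p'))%:R *: U).
  apply/matrixP => i j; rewrite !mxE; congr (_ %:R * _).
  congr (nat_of_bool _); apply/eqP/andP => [->|[/eqP Es /eqP Ep]].
    by rewrite !eqxx.
  exact: (@kdiv_kmod_inj 2 4).
rewrite mul_bmx_bcol; apply: eq_bcol => s p.
rewrite (bigD1 s) //= (bigD1 p) //= !eqxx scale1r !big1 ?addr0 //.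
  move=> s' /negPf ns; rewrite big1 // => p' _.
  by rewrite eq_sym ns scale0r mul0mx.
by move=> p' /negPf np; rewrite eq_sym np andbF scale0r mul0mx.
Qed.

Lemma input_state_bcol (psi : 'cV[C]_2) :
  input_state psi
  = bcol (fun s p => ((s == 0) && (p == 0))%:R%:M) *m psi.
Proof.
have -> : bcol (fun s p => ((s == 0) && (p == 0))%:R%:M) *m psi
  = bcol (fun s p => ((s == 0) && (p == 0))%:R *: psi).
  by rewrite bcol_mul; apply: eq_bcol => s p; rewrite mul_scalar_mx.
apply/matrixP => i j; rewrite ord1 !mxE.
have I1 (x : 'I_1) : (x == 0) = true by rewrite ord1.
rewrite !I1 !andbT -!natrM !mulnb; congr (_ %:R * psi _ _); last by rewrite ord1.
congr nat_of_bool; rewrite -!val_eqE /=.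
(* The eight ancilla basis states are checked one by one. *)
by case: (i %/ 2)%N (kron_div_lt (i : 'I_(8 * 2))) => [|[|[|[|[|[|[|[|]]]]]]]].
Qed.

Lemma output_state_bcol (chi : 'cV[C]_4) (phi : 'cV[C]_2) :
  output_state chi phi
  = bcol (fun s p => ((s == 0)%:R * chi p 0) *: phi).
Proof.
apply/matrixP => i j; rewrite ord1 !mxE.
have I1 (x : 'I_1) : (x == 0) = true by rewrite ord1.
rewrite !I1 !andbT; congr (_ * chi _ _ * phi _ _); rewrite ?ord1 //.

Qed.

End Blocks.

(** * Quaternion units, twirling and the 2 x 2 adjugate *)

Section Quaternions.
Variable C : numClosedFieldType.

Definition mx2 (a b c d : C) : 'M[C]_2 :=
  \matrix_(i, j) if i == 0 then if j == 0 then a else b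
                 else if j == 0 then c else d.

(** In Pauli matrices: 1, iZ, iY, iX. *)
Definition quat (p : 'I_4) : 'M[C]_2 :=
  nth 0 [:: mx2 1 0 0 1; mx2 'i 0 0 (- 'i); mx2 0 1 (- 1) 0; mx2 0 'i 'i 0] p.

Lemma sum_ord2 (V : nmodType) (f : 'I_2 -> V) : \sum_s f s = f 0 + f 1.
Proof.
by rewrite !big_ord_recl big_ord0 addr0; congr (_ + f _); apply: val_inj.
Qed.

Lemma ord2P (s : 'I_2) : s = 0 \/ s = 1.
Proof.
by case: s => [[|[|]] lts] //; [left | right]; apply: val_inj.
Qed.

Lemma mx2P (A B : 'M[C]_2) :
  [/\ A 0 0 = B 0 0, A 0 1 = B 0 1, A 1 0 = B 1 0 & A 1 1 = B 1 1] -> A = B.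
Proof.
case=> E00 E01 E10 E11; apply/matrixP.
by move=> i j; case: (ord2P i) => ->; case: (ord2P j) => ->.
Qed.

Lemma quat0 : quat 0 = 1%:M.
Proof. by apply: mx2P; rewrite !mxE. Qed.

Let mulii : 'i * 'i = -1 :> C.
Proof. by rewrite -expr2 sqrCi. Qed.

Lemma mxadj_quat p : mxadj (quat p) = if p == 0 then quat p else - quat p.
Proof.
rewrite -val_eqE /quat; case: p => [[|[|[|[|]]]] ltp] //=; apply: mx2P;
  rewrite !mxE /=; split;
  rewrite ?oppr0 ?opprK ?(conjC0, conjC1, conjCi, rmorphN1) //.
by rewrite raddfN /= conjCi opprK.
Qed.

Lemma twirl_quat M :
  \sum_p quat p *m M *m mxadj (quat p) = (2 * \tr M)%:M.
Proof.
under eq_bigr => p _ do rewrite mxadj_quat.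
rewrite /mxtrace sum_ord2 !big_ord_recl big_ord0 /quat /=.
by apply: mx2P; rewrite !(mxE, sum_ord2) /=; split; ring: mulii.
Qed.

Lemma twirl_quat_adj M :
  \sum_p mxadj (quat p) *m M *m quat p = (2 * \tr M)%:M.
Proof.
rewrite -twirl_quat; apply: eq_bigr => p _; rewrite mxadj_quat.
by case: ifP => // _; rewrite mulmxN !mulNmx.
Qed.

Lemma mxtrace_quat_mul p p' :
  \tr (quat p *m mxadj (quat p')) = 2 * (p == p')%:R.
Proof.
rewrite mxadj_quat /mxtrace sum_ord2 -!val_eqE /quat.
case: p => [[|[|[|[|]]]] ltp] //=; case: p' => [[|[|[|[|]]]] ltp'] //=.
all: rewrite !(mxE, sum_ord2) /=.
all: ring: mulii.
Qed.

Lemma unitary_quat p : unitary (quat p).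
Proof.
rewrite /unitary mxadj_quat /quat -val_eqE.
case: p => [[|[|[|[|]]]] ltp] //=; apply: mx2P;
  rewrite !(mxE, sum_ord2) /=; split; ring: mulii.
Qed.

Lemma mxtrace_quat p : \tr (quat p) = 2 * (p == 0)%:R.
Proof. by rewrite -mxtrace_quat_mul quat0 mxadj1 mulmx1. Qed.

(** Cayley-Hamilton in dimension 2: for determinant 1, the inverse is given by a linear expression
    in the matrix. *)
Lemma adjugate2 (A : 'M[C]_2) : \adj A = (\tr A)%:M - A.
Proof.
rewrite /mxtrace sum_ord2.
have lift00 : lift 0 0 = 1 :> 'I_2 by apply: val_inj.
have lift10 : lift 1 0 = 0 :> 'I_2 by apply: val_inj.
have mod12 : (1 %% 2 = 1)%N by [].
apply: mx2P; rewrite !mxE /cofactor !det_mx11 !mxE /= lift00 lift10 mod12.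
by split; ring.
Qed.

Lemma adjugate2M (A B : 'M[C]_2) : \adj (A *m B) = \adj B *m \adj A.
Proof.
rewrite !adjugate2 /mxtrace !sum_ord2.
by apply: mx2P; rewrite !(mxE, sum_ord2) /=; split; ring.
Qed.

Lemma adjugate_quat p : \adj (quat p) = mxadj (quat p).
Proof.
rewrite adjugate2 mxtrace_quat mxadj_quat.
have [->|_] := eqVneq; first by rewrite quat0 mulr1 -[2%R]/(1 + 1) raddfD /= addrK.
by rewrite mulr0 raddf0 add0r.
Qed.

(** Parseval: the q_p / sqrt 2 form an orthonormal basis for the trace inner product. *)
Lemma sum_norm_mxtrace_quat (U : 'M[C]_2) :
  \sum_p (\tr (mxadj (quat p) *m U))^* * \tr (mxadj (quat p) *m U)
  = 2 * \tr (U *m mxadj U).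
Proof.
have conj_tr p : (\tr (mxadj (quat p) *m U))^* = \tr (mxadj U *m quat p).
  by rewrite -[quat p in RHS]mxadjK -mxadjM [RHS]mxtrace_tr trace_map_mx.
under eq_bigr => p _ do rewrite conj_tr mxadj_quat.
rewrite !big_ord_recl big_ord0 /quat /= /mxtrace !(mxE, sum_ord2) /=.
ring: mulii.
Qed.

End Quaternions.

(** * Gates and states of the circuit; unitarity of the gates *)

Section Circuit.
Variable C : numClosedFieldType.
Local Notation quat := (@quat C).

(* The parity condition makes [spread] collect the sectors (0,0), (1,1), (1,2),
   (1,3), on which [conj_state] lives, into the sector s = 0. *)
Definition spread (r : 'I_4 -> 'M[C]_2) : 'M[C]_16 :=
  bmx (fun s p s' p' =>
    if (s == 0) == ((s' == 0) == (p' == 0)) then 2^-1 *: (r p' *m r p) else 0).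

(* Sends the column (N q_p)_p to (adj N q_p)_p, because adj N = tr N - N and
   tr N = 1/2 sum_p q_p^* N q_p. *)
Definition adj_refl : 'M[C]_16 :=
  reflection 2^-1 (bcol (fun s p => if s == 0 then quat p else 0)).

(* Up to a sign, exchanges |0,0> (x) v with
   3^(-1/2) sum_(p <> 0) |x,p> (x) q_p v. *)
Definition flip (x : 'I_2) : 'M[C]_16 :=
  reflection 3^-1 (bcol (fun s p =>
    if p == 0 then if s == 0 then (sqrtC 3)%:M else 0
    else if s == x then - quat p else 0)).

(** I(a, b) with psi stripped off, [\adj U] standing for the inverse. *)
Definition inv_state (a b : C) (U : 'M[C]_2) : 'M[C]_(16, 2) :=
  bcol (fun s p =>
    if s == 0 then (if p == 0 then a else b) *: (\adj U *m quat p) else 0).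

(** C(c, e) in the same form. At p = 0 the factor [U *m \adj U], the identity when det U = 1, is
    kept so that all p share one formula. *)
Definition conj_state (c e : C) (U : 'M[C]_2) : 'M[C]_(16, 2) :=
  bcol (fun s p =>
    if (s == 0) == (p == 0)
    then (if p == 0 then c else e) *: (U *m quat p *m \adj U) else 0).

(** The product of rows p and p' is a twirl of [r p *m mxadj (r p')]; it yields 4 if p = p' and 0
    otherwise, which the two factors 1/2 normalise. *)
Lemma unitary_spread r :
  (forall M, \sum_p r p *m M *m mxadj (r p) = (2 * \tr M)%:M) ->
  (forall p p', \tr (r p *m mxadj (r p')) = 2 * (p == p')%:R) ->
  unitary (spread r).
Proof.
move=> twirl_r tr_r; rewrite /unitary mxadj_bmx mul_bmx; apply: bmx1 => s p s' p'.
rewrite exchange_big /=.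
(* For fixed [b], the parity condition allows exactly one [a] for each [s], and different ones for
   different [s]. *)
have term b : \sum_(a : 'I_2)
    (if (s == 0) == ((a == 0) == (b == 0)) then 2^-1 *: (r b *m r p) else 0)
    *m mxadj (if (s' == 0) == ((a == 0) == (b == 0))
              then 2^-1 *: (r b *m r p') else 0)
  = ((s == s')%:R * (2^-1 * 2^-1))
      *: (r b *m (r p *m mxadj (r p')) *m mxadj (r b)).
  have E : (2^-1 *: (r b *m r p)) *m mxadj (2^-1 *: (r b *m r p'))
    = (2^-1 * 2^-1) *: (r b *m (r p *m mxadj (r p')) *m mxadj (r b)).
    rewrite mxadjZ fmorphV rmorph_nat mxadjM -scalemxAl -scalemxAr scalerA.
    by rewrite !mulmxA.
  rewrite sum_ord2; case: (ord2P s) => ->; case: (ord2P s') => ->;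
    case: (b == 0); rewrite /= ?eqxx /= ?mxadj0 ?mulmx0 ?mul0mx ?addr0 ?add0r;
    by rewrite ?mul1r ?mul0r ?scale0r ?E.
under eq_bigr => b _ do rewrite term.
rewrite -scaler_sumr twirl_r tr_r scale_scalar_mx; congr _%:M.
by rewrite -mulnb natrM; field.
Qed.

Lemma unitary_adj_refl : unitary adj_refl.
Proof.
apply: unitary_reflection; first by rewrite fmorphV rmorph_nat.
rewrite mxadj_bcol_mul sum_ord2 /= [X in _ + X]big1 => [|p _]; last first.
  by rewrite mulmx0.
under eq_bigr => p _ do rewrite (mulmx1C (unitary_quat C p)).
rewrite addr0 sumr_const card_ord -scaler_nat scalerA scale_scalar_mx.
by congr _%:M; field.
Qed.

Lemma sum_ord4_neq0 (V : zmodType) (f : 'I_4 -> V) v :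
  (forall p, p != 0 -> f p = v) -> \sum_p f p = f 0 + v *+ 3.
Proof.
move=> fE; rewrite (bigD1 0) //= (eq_bigr (fun=> v)) // sumr_const.
by rewrite cardC1 card_ord.
Qed.

Lemma sqrtC3_conj : (sqrtC 3 : C)^* = sqrtC 3.
Proof. by apply: geC0_conj; rewrite sqrtC_ge0 ler0n. Qed.

Lemma sqrtC3_sqr : sqrtC 3 * sqrtC 3 = 3 :> C.
Proof. by rewrite -expr2 sqrtCK. Qed.

Lemma sqrtC3_neq0 : sqrtC 3 != 0 :> C.
Proof. by rewrite sqrtC_eq0 pnatr_eq0. Qed.

Lemma unitary_flip x : unitary (flip x).
Proof.
apply: unitary_reflection; first by rewrite fmorphV rmorph_nat.
(* The block at p = 0 contributes 3 and the three others 1 each: 6 / 3 = 2. *)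
rewrite mxadj_bcol_mul exchange_big /= (@sum_ord4_neq0 _ _ 1%:M) => [|p /negPf p0].
  rewrite eqxx sum_ord2 /= mxadj0 mul0mx addr0 -[(sqrtC 3)%:M]scalemx1.
  rewrite mxadjZ mxadj1 -scalemxAl.
  rewrite mul1mx scalerA sqrtC3_conj sqrtC3_sqr -[1%:M *+ 3]scaler_nat -scalerDl.
  by rewrite scalerA scale_scalar_mx; congr _%:M; field.
rewrite p0 sum_ord2; case: (ord2P x) => -> /=;
  by rewrite mxadj0 mul0mx ?addr0 ?add0r mxadjN mulmxN mulNmx opprK
             (mulmx1C (unitary_quat C p)).
Qed.

(** Kept general in [r]: the family q_p serves before a query, its adjoints serve in the last
    gate. *)
Lemma spread_conj_state r c e U :
  spread r *m conj_state c e U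
  = bcol (fun s p => if s == 0 then
      \sum_l ((if l == 0 then c else e) / 2)
              *: (r l *m r p *m (U *m quat l *m \adj U)) else 0).
Proof.
rewrite mul_bmx_bcol; apply: eq_bcol => s p; rewrite exchange_big /=.
have [->|s1] : s = 0 \/ s = 1 by exact: ord2P.
  rewrite eqxx; apply: eq_bigr => l _; rewrite sum_ord2 eqxx.
  case: (l == 0); rewrite /= ?mul0mx ?mulmx0 ?addr0 ?add0r;
  by rewrite -scalemxAl -scalemxAr scalerA mulrC.
rewrite s1 /= big1 // => l _; rewrite sum_ord2 /=.
by case: (l == 0); rewrite /= ?mul0mx ?mulmx0 ?addr0.
Qed.

(** * Action of the gates for a fixed U in SU(2) *)

Variable U : 'M[C]_2.
Hypothesis SU : SU2 U.

Let mulUa : U *m \adj U = 1%:M.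
Proof. by rewrite mul_mx_adj SU.2. Qed.

Lemma invmx_SU2 : invmx U = \adj U.
Proof. by rewrite /invmx unitmxE SU.2 unitr1 invr1 scale1r. Qed.

(** The reflection replaces [U *m quat l] by its adjugate, so that term l becomes q_l^* U^-1 q_p U
    q_l U^-1; summed over l with equal weights, this is a twirl. *)
Lemma conj_to_inv c e :
  adj_refl *m (on_target U *m (spread quat *m conj_state c e U))
  = inv_state ((c + 3 * e) / 2) ((c - e) / 2) U.
Proof.
rewrite spread_conj_state mul_on_target_bcol mul_reflection_bcol.
apply: eq_bcol => s p; rewrite sum_ord2 /=.
rewrite [X in _ *m (_ + X)]big1 => [|p' _]; last first.
  by rewrite !mulmx0.
rewrite addr0; case: (s == 0); last by rewrite mulmx0 mul0mx scaler0 subr0.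
pose k (l : 'I_4) := (if l == 0 then c else e) / 2.
have inner l : \sum_p' mxadj (quat p') *m (U *m quat l) *m quat p'
   = (2 * \tr (U *m quat l))%:M by exact: twirl_quat_adj.
(* Action of [adj_refl] on the column N q_p X, for N = [U *m quat l]. *)
have term l X :
    2^-1 *: (quat p *m \sum_p' mxadj (quat p')
                *m (U *m (k l *: (quat l *m quat p' *m X))))
    - U *m (k l *: (quat l *m quat p *m X))
  = k l *: (\adj (U *m quat l) *m quat p *m X).
  have -> : \sum_p' mxadj (quat p') *m (U *m (k l *: (quat l *m quat p' *m X)))
      = (k l * (2 * \tr (U *m quat l))) *: X.
    rewrite -scalerA -[(2 * _) *: X]mul_scalar_mx -inner mulmx_suml scaler_sumr.
    by apply: eq_bigr => p' _; rewrite -!scalemxAr !mulmxA.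
  rewrite adjugate2 !mulmxBl scalerBr mul_scalar_mx -!scalemxAl -!scalemxAr !scalerA.
  by rewrite !mulmxA; congr (_ *: _ - _); field.
transitivity (\sum_l k l *:
    (\adj (U *m quat l) *m quat p *m (U *m quat l *m \adj U))).
  under eq_bigr => p' _ do rewrite !mulmx_sumr.
  rewrite exchange_big /= mulmx_sumr scaler_sumr mulmx_sumr -sumrB.
  by apply: eq_bigr => l _; rewrite -term.
(* The weights split into a uniform part, which is twirled, and an excess at l = 0, which gives U^-1
   q_p. *)
have kE l : k l = (if l == 0 then (c - e) / 2 else 0) + e / 2.
  by rewrite /k; case: ifP => _; field.
under eq_bigr => l _ do rewrite kE scalerDl.
rewrite big_split /= (bigD1 0) //=.
rewrite [X in _ + X + _]big1 => [|l /negPf ->]; last first.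
  by rewrite scale0r.
rewrite addr0 -scaler_sumr quat0 !mulmx1 mulUa mulmx1.
have -> : \sum_l \adj (U *m quat l) *m quat p *m (U *m quat l *m \adj U)
    = (2 * \tr (quat p)) *: \adj U.
  (* Conjugation by U preserves the trace, so the twirl vanishes unless p = 0. *)
  have -> : \tr (quat p) = \tr (\adj U *m quat p *m U).
    by rewrite -mulmxA mxtrace_mulC -mulmxA mulUa mulmx1.
  rewrite -mul_scalar_mx -twirl_quat_adj mulmx_suml; apply: eq_bigr => l _.
  by rewrite adjugate2M adjugate_quat !mulmxA.
rewrite mxtrace_quat; case: eqP => [->|_].
  rewrite quat0 mulmx1 mulr1 scalerA -scalerDl.
  by congr (_ *: _); field.
by rewrite /= !mulr0 scale0r scaler0 addr0.
Qed.

(** [flip 1] moves the |0,0> branch to the |1,p> as q_p U^-1, which the query conjugates; on the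
    |0,p> the query leaves q_p, which [flip 0] gathers into |0,0>. The two signs cancel. *)
Lemma inv_to_conj a b :
  flip 0 *m (on_target U *m (flip 1 *m inv_state a b U))
  = conj_state (sqrtC 3 * b) (a / sqrtC 3) U.
Proof.
have s3_neq0 := sqrtC3_neq0.
have adj_s3 : mxadj (sqrtC 3)%:M = (sqrtC 3)%:M :> 'M[C]_2.
  by rewrite -[(sqrtC 3)%:M]scalemx1 mxadjZ mxadj1 sqrtC3_conj.
have flip1 : flip 1 *m inv_state a b U = bcol (fun s p =>
    if p == 0 then 0 else if s == 0 then - b *: (\adj U *m quat p)
                          else - (a / sqrtC 3) *: (quat p *m \adj U)).
  rewrite mul_reflection_bcol exchange_big /=.
  rewrite (@sum_ord4_neq0 _ _ 0) => [|p /negPf p0].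
    apply: eq_bcol => s p; rewrite sum_ord2 /= quat0 mulmx1 mulmx0 !addr0 mul0rn.
    rewrite addr0 adj_s3 mul_scalar_mx scalerA.
    case: eqP => [->|_]; case: (ord2P s) => ->; rewrite ?eqxx /=.
    - rewrite mul_scalar_mx quat0 mulmx1 !scalerA -scalerBl.
      rewrite [_ - _](_ : _ = 0) ?scale0r //.
      by field: sqrtC3_sqr.
    - by rewrite mul0mx scaler0 subr0.
    - by rewrite mul0mx scaler0 sub0r scaleNr.
    - rewrite subr0 mulNmx -scalemxAr scalerN scalerA scaleNr.
      by congr (- (_ *: _)); field: sqrtC3_sqr.
  by rewrite p0 sum_ord2 /= mxadj0 mul0mx mulmx0 addr0.
rewrite flip1 mul_on_target_bcol mul_reflection_bcol exchange_big /=.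
(* Each |0,p> block is now -b q_p, so its overlap with the reflected direction is b. *)
rewrite (@sum_ord4_neq0 _ _ b%:M) => [|p /negPf p0]; last first.
  rewrite p0 sum_ord2 /= mxadj0 mul0mx addr0 mxadjN mulNmx.
  rewrite -!scalemxAr scaleNr opprK (mulmxA U) mulUa mul1mx.
  by rewrite (mulmx1C (unitary_quat C p)) scalemx1.
have -> : b%:M *+ 3 = (3 * b)%:M :> 'M[C]_2 by rewrite mulr_natl raddfMn.
apply: eq_bcol => s p; rewrite sum_ord2 /= !mulmx0 !addr0 add0r.
case: eqP => [->|_]; case: (ord2P s) => ->; rewrite ?eqxx /=.
- rewrite mulmx0 subr0 quat0 mulmx1 mulUa scalemx1 -scalar_mxM scale_scalar_mx.
  by congr _%:M; field.
- by rewrite mul0mx mulmx0 scaler0 subr0.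
- rewrite mul_mx_scalar -scalemxAr mulmxA mulUa mul1mx !scalerN scaleNr opprK.
  by rewrite scalerA mulKf ?pnatr_eq0 // addNr.
- by rewrite mul0mx scaler0 sub0r scaleNr mulmxN opprK -scalemxAr mulmxA.
Qed.

(** Coordinates of U in the basis q_p, that is, its normalised Choi vector in a fixed basis. *)
Definition choi_vec : 'cV[C]_4 := \col_p (\tr (mxadj (quat p) *m U) / 2).

Lemma unit_choi_vec : unit_vec choi_vec.
Proof.
apply/matrixP => i j; rewrite !ord1 !mxE eqxx.
transitivity (2^-1 * 2^-1 * (2 * \tr (U *m mxadj U))).
  rewrite -sum_norm_mxtrace_quat mulr_sumr; apply: eq_bigr => p _.
  by rewrite !mxE rmorphM /= fmorphV rmorph_nat; field.
by rewrite SU.1 mxtrace1 /=; field.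
Qed.

(** Equal coefficients make the sum over l a full twirl of q_p^* U: only a scalar is left in front
    of U^-1, so the target decouples from the ancillas. *)
Lemma spread_adj_conj_state :
  spread (fun p => mxadj (quat p)) *m conj_state 2^-1 2^-1 U
  = bcol (fun s p => ((s == 0)%:R * choi_vec p 0) *: invmx U).
Proof.
rewrite spread_conj_state invmx_SU2; apply: eq_bcol => s p.
case: (s == 0); last by rewrite mul0r scale0r.
rewrite mul1r mxE.
have -> : (\tr (mxadj (quat p) *m U) / 2) *: \adj U
    = (2^-1 / 2) *: ((2 * \tr (mxadj (quat p) *m U))%:M *m \adj U).
  by rewrite mul_scalar_mx scalerA; congr (_ *: _); field.
rewrite -twirl_quat_adj mulmx_suml scaler_sumr; apply: eq_bigr => l _.
by rewrite if_same !mulmxA.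
Qed.

(** U cancels in C(1, 0), so the input serves as starting state for every U. *)
Lemma input_state_conj psi : input_state psi = conj_state 1 0 U *m psi.
Proof.
rewrite input_state_bcol; congr (_ *m _); apply: eq_bcol => s p.
have [->|_] := eqVneq p 0; last first.
  by rewrite andbF scale0r if_same -scalemx1 scale0r.
rewrite andbT quat0 mulmx1 mulUa scale1r eqb_id.
by case: (s == 0); rewrite // -scalemx1 scale0r.
Qed.

End Circuit.

Theorem theorem1 (C : numClosedFieldType) :
  exists V0 V1 V2 V3 V4 : 'M[C]_16,
    [/\ unitary V0, unitary V1, unitary V2, unitary V3 & unitary V4] /\
    forall U : 'M[C]_2, SU2 U ->
      exists chi : 'cV[C]_4, unit_vec chi /\
        forall psi : 'cV[C]_2, unit_vec psi ->
          C_IV V0 V1 V2 V3 V4 U *m input_state psi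
          = output_state chi (invmx U *m psi).
Proof.
pose G := spread (@quat C); pose Gdag := spread (fun p => mxadj (quat C p)).
pose W := flip C 1 *m adj_refl C.
have uG : unitary G.
  by apply: unitary_spread => *; rewrite ?twirl_quat ?mxtrace_quat_mul.
have uGdag : unitary Gdag.
  apply: unitary_spread => [M|p p'].
    by under eq_bigr do rewrite mxadjK; exact: twirl_quat_adj.
  by rewrite mxadjK mxtrace_mulC mxtrace_quat_mul eq_sym.
have uW : unitary W.
  by apply: unitaryM; [exact: unitary_flip | exact: unitary_adj_refl].
(* Each gate between two queries ends one conversion and begins the next; the last one undoes the
   entanglement by [Gdag]. *)
exists G, W, (G *m flip C 0), W, (Gdag *m flip C 0); split.
  by split=> //; apply: unitaryM => //; exact: unitary_flip.
move=> U SU; exists (choi_vec U); split; first exact: unit_choi_vec.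
move=> psi _; rewrite (input_state_conj SU) mulmxA.
transitivity
  (bcol (fun s p => ((s == 0)%:R * choi_vec U p 0) *: invmx U) *m psi).
  congr (_ *m psi); rewrite -spread_adj_conj_state // /C_IV /W -!mulmxA.
  rewrite !(conj_to_inv SU, inv_to_conj SU).
  (* Both final coefficients reduce to 1/2. *)
  congr (_ *m conj_state _ _ U); by field: (sqrtC3_sqr C); exact: sqrtC3_neq0.
rewrite output_state_bcol bcol_mul; apply: eq_bcol => s p.
by rewrite scalemxAl.
Qed.
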